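(* Suppose that $W_{\boldsymbol\lambda}$ is a conditionally positive definite (CPD) unilateral weighted shift with weights $\boldsymbol\lambda=\{\lambda_k\}_{k=0}^\infty$ and $(b,c,\nu)$ is its scalar representing triplet. Let $n\geq2$ be an integer and let $\{t_j\}_{j=1}^n\subseteq(0,\infty)$. Set $t_0:=\lambda_0=(1+b+c)^{1/2}$ and $\boldsymbol t_k:=(t_k,\ldots,t_1)$ for $k=1,\ldots,n$. Then the following statements are equivalent: (i) $W_{(t_n,\ldots,t_1,\lambda_0,\lambda_1,\ldots)}$ is a CPD $n$-step backward extension of $W_{\boldsymbol\lambda}$, (ii) the sequence $\{t_j\}_{j=1}^n$ satisfies the following conditions (with the convention $\prod_{j=1}^0t_j^2=1$): $$\frac{1}{t_k^2}=\Big(\prod_{j=1}^{k-1}t_j^2\Big)\Big(\int_{\mathbb{R}_+}\frac{1}{x^k}\,d\nu(x)+2c\Big)+2-t_{k-1}^2,\quad k=1,\ldots,n-1,$$ $$\frac{1}{t_n^2}\geq\Big(\prod_{j=1}^{n-1}t_j^2\Big)\Big(\int_{\mathbb{R}_+}\frac{1}{x^n}\,d\nu(x)+2c\Big)+2-t_{n-1}^2.$$ Moreover, if (ii) holds, then for $k=1,\ldots,n$, $W_{(t_k,\ldots,t_1,\lambda_0,\lambda_1,\ldots)}$ is a CPD $k$-step backward extension of $W_{\boldsymbol\lambda}$ with the scalar representing triplet $(b_{\boldsymbol t_k},c_{\boldsymbol t_k},\nu_{\boldsymbol t_k})$ given by $$b_{\boldsymbol t_k}=t_k^2-c\prod_{j=1}^kt_j^2-1,\qquad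 c_{\boldsymbol t_k}=c\prod_{j=1}^kt_j^2,$$ $$\nu_{\boldsymbol t_k}(\varDelta)=\Big(\prod_{j=1}^kt_j^2\Big)\int_{\varDelta}\frac{1}{x^k}\,d\nu(x)+\nu_{\boldsymbol t_k}(\{0\})\,\delta_0(\varDelta)\quad\text{for every Borel set }\varDelta\subseteq\mathbb{R}_+,$$ $$\nu_{\boldsymbol t_k}(\{0\})=1-\Big(\prod_{j=1}^kt_j^2\Big)\Big(\int_{\mathbb{R}_+}\frac{1}{x^k}\,d\nu(x)+2c\Big)+t_k^2(t_{k-1}^2-2).$$ In particular, $\nu_{\boldsymbol t_k}(\{0\})=0$ for $k=1,\ldots,n-1$.
   Context: $\mathbb{N}=\{1,2,\dots\}$, $\mathbb{Z}_+=\{0,1,2,\dots\}$, $\mathbb{R}_+=[0,\infty)$; all measures are positive; $\delta_0$ is the probability measure concentrated at $0$. In integrals of $\frac1{x^k}$ the convention $\frac10=\infty$ is used. The polynomials $Q_n$ are $Q_0=Q_1=0$ and $Q_n(x)=\sum_{j=0}^{n-2}(n-j-1)x^j$ for $n\geq 2$. A real sequence $\{\gamma_n\}_{n=0}^\infty$ is CPD if $\sum_{i,j=0}^k \gamma_{i+j}\alpha_i\bar\alpha_j\geq 0$ for every finite sequence $\alpha_0,\dots,\alpha_k\in\mathbb{C}$ with $\sum_{j=0}^k\alpha_j=0$. A bounded operator $T$ on a complex Hilbert space $\mathcal{H}$ is CPD if $\{\|T^nh\|^2\}_{n=0}^\infty$ is CPD for every $h\in\mathcal{H}$. For a bounded sequence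 $\boldsymbol\lambda=\{\lambda_n\}_{n=0}^\infty$ of positive reals, $W_{\boldsymbol\lambda}$ is the bounded operator on $\ell^2$ with $W_{\boldsymbol\lambda}e_n=\lambda_ne_{n+1}$ ($\{e_n\}$ the standard orthonormal basis); $\hat\lambda_0=1$ and $\hat\lambda_n=\lambda_0^2\cdots\lambda_{n-1}^2$ for $n\geq1$. If $W_{\boldsymbol\lambda}$ is CPD, its scalar representing triplet is the unique $(b,c,\nu)$ with $b\in\mathbb{R}$, $c\in\mathbb{R}_+$, $\nu$ a compactly supported finite Borel measure on $\mathbb{R}_+$ with $\nu(\{1\})=0$ and $\hat\lambda_n=1+bn+cn^2+\int_{\mathbb{R}_+}Q_n\,d\nu$ for all $n\in\mathbb{Z}_+$. For $n\in\mathbb{N}$ and positive reals $t_1,\dots,t_n$, $W_{(t_n,\ldots,t_1,\lambda_0,\lambda_1,\ldots)}$ is called a CPD $n$-step backward extension of $W_{\boldsymbol\lambda}$ if it is CPD. *)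

(* Defs.v *)
From HB Require Import structures.
From mathcomp Require Import all_boot all_order all_algebra.
From mathcomp Require Import all_classical all_reals all_analysis.
From mathcomp Require Import complex.

Set Implicit Arguments.
Unset Strict Implicit.
Unset Printing Implicit Defensive.

Import Order.TTheory GRing.Theory Num.Theory.
Import numFieldNormedType.Exports.

Local Open Scope classical_set_scope.
Local Open Scope ring_scope.
Local Open Scope complex_scope.

(* The quadratic form takes values in R[i]; there, [0 <= z] means that z is
   real and nonnegative. *)
Definition cpd_seq (R : realType) (gamma : nat -> R) : Prop :=
  forall (k : nat) (alpha : 'I_k.+1 -> R[i]),
    \sum_(j < k.+1) alpha j = 0 ->
    0 <= \sum_(i < k.+1) \sum_(j < k.+1)
           (gamma (i + j)%N)%:C * alpha i * (alpha j)^*.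

(* The complex Hilbert space l^2, as a set of complex sequences. *)
Definition ell2 (R : realType) : set (nat -> R[i]) :=
  [set x | cvgn (series (fun k => ComplexField.Normc.normc (x k) ^+ 2))].

(* Meaningful only on [ell2]. *)
Definition ell2_norm (R : realType) (x : nat -> R[i]) : R :=
  Num.sqrt (limn (series (fun k => ComplexField.Normc.normc (x k) ^+ 2))).

Definition ell2_basis (R : realType) (n : nat) : nat -> R[i] :=
  fun k => (k == n)%:R.

Definition bounded_operator (R : realType)
    (T : (nat -> R[i]) -> (nat -> R[i])) : Prop :=
  (forall (a : R[i]) (x y : nat -> R[i]), ell2 x -> ell2 y ->
     T (a *: x + y) = a *: T x + T y) /\
  (exists M : R, forall x, ell2 x ->
     ell2 (T x) /\ ell2_norm (T x) <= M * ell2_norm x).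

Definition cpd_operator (R : realType)
    (T : (nat -> R[i]) -> (nat -> R[i])) : Prop :=
  bounded_operator T /\
  forall h, ell2 h -> cpd_seq (fun n => ell2_norm (iter n T h) ^+ 2).

Definition wshift (R : realType) (lam : nat -> R) (x : nat -> R[i]) :
    nat -> R[i] :=
  fun k => if k is m.+1 then (lam m)%:C * x m else 0.

Definition hat (R : realType) (lam : nat -> R) (n : nat) : R :=
  \prod_(0 <= j < n) lam j ^+ 2.

(* For n = 0, 1 the index range is empty, so that Q 0 = Q 1 = 0. *)
Definition Q (R : realType) (n : nat) : {poly R} :=
  \poly_(j < n.-1) (n - j - 1)%:R.

(* A finite Borel measure on R_+ with compact support is encoded as a finite
   Borel measure on R that vanishes outside a compact subset of R_+. *)
Definition scalar_triplet (R : realType) (lam : nat -> R) (b c : R)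
    (nu : {finite_measure set (measurableTypeR R) -> \bar R}) : Prop :=
  [/\ 0 <= c,
      exists K : set R, [/\ compact K, K `<=` `[0, +oo[ & nu (~` K) = 0%E],
      nu [set 1] = 0%E &
      forall n : nat,
        ((hat lam n)%:E = (1 + b * n%:R + c * n%:R ^+ 2)%:E
           + \int[nu]_(x in `[0%R, +oo[) ((Q R n).[x])%:E)%E].

(* The weights (t_k, ..., t_1, lam_0, lam_1, ...); the value t 0 is not used. *)
Definition backward_weights (R : realType) (k : nat) (t lam : nat -> R) :
    nat -> R :=
  fun i => if (i < k)%N then t (k - i)%N else lam (i - k)%N.

Definition cpd_backward_extension (R : realType) (k : nat) (t lam : nat -> R) :
    Prop :=
  cpd_operator (wshift (backward_weights k t lam)).

(* The integral of 1/x^k over D; the inverse is the one of \bar R, for which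
   0^-1 = +oo. *)
Definition int_invX (R : realType)
    (nu : {finite_measure set (measurableTypeR R) -> \bar R})
    (k : nat) (D : set R) : \bar R :=
  (\int[nu]_(x in D) ((x ^+ k)%:E)^-1)%E.

Definition prod_sqr (R : realType) (t : nat -> R) (k : nat) : R :=
  \prod_(1 <= j < k.+1) t j ^+ 2.

Definition ext_rhs (R : realType) (c : R)
    (nu : {finite_measure set (measurableTypeR R) -> \bar R})
    (t : nat -> R) (k : nat) : \bar R :=
  ((prod_sqr t k.-1)%:E * (int_invX nu k `[0%R, +oo[ + (2 * c)%:E)
     + (2 - t k.-1 ^+ 2)%:E)%E.

Definition ext_conditions (R : realType) (c : R)
    (nu : {finite_measure set (measurableTypeR R) -> \bar R})
    (n : nat) (t : nat -> R) : Prop :=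
  (forall k : nat, (1 <= k <= n.-1)%N ->
     (1 / t k ^+ 2)%:E = ext_rhs c nu t k) /\
  (ext_rhs c nu t n <= (1 / t n ^+ 2)%:E)%E.

Lemma wshift_basis (R : realType) (lam : nat -> R) (n : nat) :
  wshift lam (@ell2_basis R n) = (lam n)%:C *: ell2_basis R n.+1.
Proof.
apply/funext => -[|k].
  exact: (esym (mulr0 _)).
change ((lam k)%:C * (k == n)%:R = (lam n)%:C * (k == n)%:R :> R[i]).
by have [->//|_] := eqVneq k n; rewrite !mulr0.
Qed.

Lemma wshift_bounded (R : realType) (lam : nat -> R) :
  (forall k, 0 < lam k) -> (exists M, forall k, lam k <= M) ->
  bounded_operator (wshift lam).
Proof.
move=> lam0 [M lamM]; split=> [a x y _ _|].
  apply/funext => -[|k] /=.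
    by change (0 = a * 0 + 0 :> R[i]); rewrite mulr0 addr0.
  change ((lam k)%:C * (a * x k + y k)
    = a * ((lam k)%:C * x k) + (lam k)%:C * y k :> R[i]).
  by rewrite mulrDr !mulrA [_%:C * a]mulrC.
have M0 : 0 <= M by rewrite (le_trans (ltW (lam0 0)))//.
pose N := @ComplexField.Normc.normc R.
exists M => x xl2; rewrite /ell2 /= in xl2 *.
set v := fun k => _ in xl2; set w := fun k => _.
have v0 k : 0 <= v k by rewrite sqr_ge0.
have w0 k : 0 <= w k by rewrite sqr_ge0.
have wS k : w k.+1 = lam k ^+ 2 * v k.
  rewrite /w /v /= ComplexField.Normc.normcM exprMn; congr (_ * _).
  by rewrite /= expr0n/= addr0 sqr_sqrtr// sqr_ge0.
have w00 : w 0%N = 0 by rewrite /w /= expr0n/= addr0 sqrtr0 expr0n.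
have wle k : w k.+1 <= M ^+ 2 * v k.
  by rewrite wS ler_wpM2r// ler_sqr// nnegrE// ltW.
have vnd : nondecreasing_seq (series v) by exact/nondecreasing_series.
have vlim k : series v k <= limn (series v) by exact: nondecreasing_cvgn_le.
have lim0 : 0 <= limn (series v).
  by apply: le_trans (vlim 0%N); rewrite /series /= big_geq.
have wub k : series w k <= M ^+ 2 * limn (series v).
  case: k => [|k]; first by rewrite /series /= big_geq// mulr_ge0// sqr_ge0.
  rewrite /series /= big_nat_recl//= w00 add0r.
  apply: le_trans (ler_sum _ (fun i _ => wle i)) _.
  by rewrite -mulr_sumr ler_wpM2l// ?sqr_ge0//; exact: vlim.
have wcv : cvgn (series w).
  apply: nondecreasing_is_cvgn; first exact/nondecreasing_series.
  by exists (M ^+ 2 * limn (series v)) => _ [k _ <-].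
split=> //; rewrite /ell2_norm -(ger0_norm M0) -sqrtr_sqr -sqrtrM ?sqr_ge0//.
by rewrite ler_wsqrtr//; apply: limr_le => //; exact: nearW.
Qed.

(* Main.v *)
Require Import Defs.
From HB Require Import structures.
From mathcomp Require Import all_boot all_order all_algebra.
From mathcomp Require Import all_classical all_reals all_analysis.
From mathcomp Require Import measurable_realfun complex.
From mathcomp Require Import zify ring lra.

(** A sequence [g] is CPD exactly when its second difference
    [g m.+2 - 2 * g m.+1 + g m] is positive semidefinite, because a coefficient
    vector of sum zero is a polynomial divisible by ['X - 1].  For a weighted
    shift with triplet (b, c, nu) the second difference of the moments
    [hat lam] is the moment sequence of mu = nu + 2c delta_1, since the second
    difference of the polynomials [Q n] is ['X^n].  So b, c and nu can be traded
    for the two initial values of [hat lam] and the single measure mu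
    ([triplet_formulaP]).

    Let s be the second difference of the moments for the weights
    (t_k, ..., t_1, lam), and P_k the product of the squares of t_1, ..., t_k.
    Prepending a weight shifts the moments by one and multiplies them by its
    square; hence s (m + k) is P_k times the m-th moment of mu, while
    s 0 = t_k^2 t_{k-1}^2 - 2 t_k^2 + 1.  So the k-th condition of (ii) says
    that s 0 is equal to (for k = n: at least) P_k times the integral of x^-k against
    mu ([ext_conditionsE]).

    Necessity ([backward_moments]).  Let s be positive semidefinite with
    s (m + n) the m-th moment of mu.  Let u be the polynomial 1 - (1 - x/M)^j,
    where [0, M] carries mu; u is divisible by x, lies in [0, 1] on [0, M], and
    u^n / x^n increases to x^-n as j grows, with the value +oo at 0.  Testing
    positivity on p (1 - u^n) involves, apart from p^2, only multiples of x^n,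
    for which the functional is integration against mu; monotone convergence
    gives that the integral of p^2 x^-n is at most the value of the functional
    at p^2 ([riesz_sqr_ge]).  With p = 1 this is the inequality of (ii).  Then
    kappa = x^-n mu is a finite measure, and subtracting its moments from s
    leaves a positive semidefinite sequence that vanishes from rank n on; such
    a sequence vanishes except at rank 0 ([riesz_psd_tail0]), and these are the
    equalities of (ii).

    Sufficiency ([backward_triplet]).  Given (ii), the measure
    P_k x^-k nu + a delta_0, where a is the excess of s 0 over P_k times the
    integral of x^-k against mu, has the moments required of a triplet for the
    k-step extension, and every bounded shift with positive weights that has a
    triplet is CPD ([triplet_cpd]). *)

Set Implicit Arguments.
Unset Strict Implicit.
Unset Printing Implicit Defensive.

Import Order.TTheory GRing.Theory Num.Theory.
Import numFieldNormedType.Exports.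

Local Open Scope classical_set_scope.
Local Open Scope ring_scope.

(** * Conditionally positive definite sequences *)

(** The linear functional on polynomials that sends ['X^m] to [s m]. *)
Definition riesz (R : realType) (s : nat -> R) (p : {poly R}) : R :=
  \sum_(i < size p) s i * p`_i.

Lemma riesz_widen (R : realType) (s : nat -> R) (p : {poly R}) (k : nat) :
  (size p <= k)%N -> riesz s p = \sum_(i < k) s i * p`_i.
Proof.
move=> pk; rewrite /riesz (big_ord_widen k (fun i => s i * p`_i))//.
rewrite big_mkcond/=; apply: eq_bigr => i _; case: ltnP => // ip.
by rewrite nth_default// mulr0.
Qed.

Lemma riesz_is_linear (R : realType) (s : nat -> R) :
  linear_for *%R (riesz s).
Proof.
move=> a p q; set k := maxn (size p) (size q).
rewrite (@riesz_widen _ s p k) ?leq_maxl// (@riesz_widen _ s q k) ?leq_maxr//.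
rewrite (@riesz_widen _ s _ k); last first.
  by rewrite (leq_trans (size_polyD _ _))// geq_max leq_maxr andbT
    (leq_trans (size_scale_leq _ _))// leq_maxl.
rewrite mulr_sumr -big_split/=; apply: eq_bigr => i _.
by rewrite coefD coefZ; ring.
Qed.

HB.instance Definition _ (R : realType) (s : nat -> R) :=
  GRing.isLinear.Build R {poly R} R *%R (riesz s) (riesz_is_linear s).

Lemma rieszXn (R : realType) (s : nat -> R) (k : nat) : riesz s 'X^k = s k.
Proof.
rewrite /riesz size_polyXn big_ord_recr/= big1 ?add0r => [|i _].
  by rewrite coefXn eqxx mulr1.
by rewrite coefXn ltn_eqF// mulr0.
Qed.

Lemma poly_sumXn (R : realType) (p : {poly R}) :
  p = \sum_(i < size p) p`_i *: 'X^i.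
Proof. by rewrite -poly_def coefK. Qed.

Lemma riesz_mul (R : realType) (s s' : nat -> R) (q p : {poly R}) :
  (forall i, riesz s (q * 'X^i) = s' i) -> riesz s (q * p) = riesz s' p.
Proof.
move=> qs; rewrite {1}[p]poly_sumXn mulr_sumr linear_sum/=.
by apply: eq_bigr => i _; rewrite -scalerAr linearZ/= qs mulrC.
Qed.

Lemma riesz_bilinear (R : realType) (s : nat -> R) (k : nat) (a b : nat -> R) :
  riesz s ((\poly_(i < k) a i) * (\poly_(j < k) b j)) =
  \sum_(i < k) \sum_(j < k) s (i + j)%N * a i * b j.
Proof.
rewrite !poly_def mulr_suml linear_sum/=; apply: eq_bigr => i _.
rewrite mulr_sumr linear_sum/=; apply: eq_bigr => j _.
by rewrite -scalerAl -scalerAr scalerA -exprD linearZ/= rieszXn; ring.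
Qed.

Definition diff2 (R : realType) (g : nat -> R) (m : nat) : R :=
  g m.+2 - 2 * g m.+1 + g m.

Lemma riesz_diff2 (R : realType) (g : nat -> R) (p : {poly R}) :
  riesz g (('X - 1) ^+ 2 * p) = riesz (diff2 g) p.
Proof.
apply: riesz_mul => i.
have -> : ('X - 1) ^+ 2 * 'X^i = 'X^(i.+2) - 2 *: 'X^(i.+1) + 'X^i :> {poly R}.
  by rewrite scaler_nat !exprS; ring.
by rewrite !linearD/= linearN/= linearZ/= !rieszXn.
Qed.

Lemma rieszXnM (R : realType) (s : nat -> R) (k : nat) (p : {poly R}) :
  riesz s ('X^k * p) = riesz (fun i => s (i + k)%N) p.
Proof. by apply: riesz_mul => i; rewrite -exprD rieszXn addnC. Qed.

Lemma Re_sum (R : realType) (k : nat) (F : 'I_k -> R[i]) :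
  complex.Re (\sum_(i < k) F i) = \sum_(i < k) complex.Re (F i).
Proof. by apply: (big_morph (@complex.Re R)) => // -[a b] [c d]. Qed.

Lemma Im_sum (R : realType) (k : nat) (F : 'I_k -> R[i]) :
  complex.Im (\sum_(i < k) F i) = \sum_(i < k) complex.Im (F i).
Proof. by apply: (big_morph (@complex.Im R)) => // -[a b] [c d]. Qed.

(** The imaginary part cancels by the symmetry of [g (i + j)]; positivity can
    therefore be tested on real vectors. *)
Lemma hermitian_formE (R : realType) (g : nat -> R) (k : nat)
    (alpha : 'I_k -> R[i]) :
  (\sum_(i < k) \sum_(j < k)
     (g (i + j)%N)%:C * alpha i * (alpha j)^* =
  (\sum_(i < k) \sum_(j < k) g (i + j)%N *
     (complex.Re (alpha i) * complex.Re (alpha j)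
      + complex.Im (alpha i) * complex.Im (alpha j)))%:C)%C.
Proof.
apply/eqP; rewrite eq_complex Re_sum Im_sum /=; apply/andP; split; apply/eqP.
  apply: eq_bigr => i _; rewrite Re_sum; apply: eq_bigr => j _.
  by case: (alpha i) => a b; case: (alpha j) => c d /=; ring.
set S := LHS; have SE : S = \sum_(i < k) \sum_(j < k) g (i + j)%N *
    (complex.Im (alpha i) * complex.Re (alpha j)
     - complex.Re (alpha i) * complex.Im (alpha j)).
  apply: eq_bigr => i _; rewrite Im_sum; apply: eq_bigr => j _.
  by case: (alpha i) => a b; case: (alpha j) => c d /=; ring.
suff : S = - S by lra.
rewrite {1}SE exchange_big/= SE -sumrN; apply: eq_bigr => i _.
by rewrite -sumrN; apply: eq_bigr => j _; rewrite addnC; ring.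
Qed.

Lemma cpd_seq_riesz (R : realType) (g : nat -> R) :
  cpd_seq g <-> forall p : {poly R}, p.[1] = 0 -> 0 <= riesz g (p ^+ 2).
Proof.
split=> [gcpd p p1|gpos k alpha alpha0].
  have pE : \poly_(i < (size p).+1) p`_i = p.
    apply/polyP => i; rewrite coef_poly; case: ltnP => // pi.
    by rewrite nth_default// ltnW.
  have sum0 : \sum_(j < (size p).+1) (p`_j)%:C%C = 0 :> R[i].
    rewrite -rmorph_sum/= (_ : \sum_(i < _) _ = p.[1]); first by rewrite p1.
    rewrite (horner_coef_wide 1 (leqnSn (size p))).
    by apply: eq_bigr => i _; rewrite expr1n mulr1.
  have := gcpd (size p) (fun i => (p`_i)%:C%C) sum0.
  have -> : p ^+ 2 =
      \poly_(i < (size p).+1) p`_i * \poly_(i < (size p).+1) p`_i.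
    by rewrite pE expr2.
  rewrite hermitian_formE ler0c riesz_bilinear => /le_trans; apply.
  rewrite le_eqVlt; apply/orP; left; apply/eqP.
  by apply: eq_bigr => i _; apply: eq_bigr => j _ /=; ring.
pose A f := \poly_(i < k.+1) f (alpha (inord i)) : {poly R}.
have A1 f : (A f).[1] = \sum_(j < k.+1) f (alpha j).
  rewrite horner_poly; apply: eq_bigr => i _.
  by rewrite expr1n mulr1 inord_val.
have Arb f : riesz g (A f ^+ 2) = \sum_(i < k.+1) \sum_(j < k.+1)
    g (i + j)%N * (f (alpha i) * f (alpha j)).
  rewrite expr2 riesz_bilinear; apply: eq_bigr => i _; apply: eq_bigr => j _.
  by rewrite !inord_val mulrA.
rewrite hermitian_formE ler0c.
have -> : \sum_(i < k.+1) \sum_(j < k.+1) g (i + j)%N *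
     (complex.Re (alpha i) * complex.Re (alpha j)
      + complex.Im (alpha i) * complex.Im (alpha j)) =
    riesz g (A (@complex.Re R) ^+ 2) + riesz g (A (@complex.Im R) ^+ 2).
  rewrite !Arb -big_split/=; apply: eq_bigr => i _.
  by rewrite -big_split/=; apply: eq_bigr => j _; rewrite mulrDr.
by rewrite addr_ge0// gpos// A1 -?Re_sum -?Im_sum alpha0.
Qed.

(** A vector of coefficients of sum zero is a polynomial [('X - 1) * q] and
    multiplication by [('X - 1) ^+ 2] corresponds to the second difference, so
    conditional positivity of [g] is plain positivity of its second
    difference. *)
Lemma cpd_seq_diff2 (R : realType) (g : nat -> R) :
  cpd_seq g <-> forall p : {poly R}, 0 <= riesz (diff2 g) (p ^+ 2).
Proof.
rewrite cpd_seq_riesz; split=> [gpos p|gpos p /eqP/factor_theorem[q ->]].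
  by rewrite -riesz_diff2 -exprMn; apply: gpos; rewrite !hornerE; ring.
by rewrite mulrC exprMn riesz_diff2.
Qed.

(** * Powers of weighted shifts *)

Lemma iter_wshift_lt (R : realType) (w : nat -> R) (x : nat -> R[i])
    (n m : nat) : (m < n)%N -> iter n (wshift w) x m = 0.
Proof. by elim: n m => [//|n IH] [|m]//= mn; rewrite IH// mulr0. Qed.

Lemma iter_wshift_add (R : realType) (w : nat -> R) (x : nat -> R[i])
    (n m : nat) :
  iter n (wshift w) x (m + n)%N =
  (\prod_(0 <= j < n) w (m + j)%N)%:C%C * x m.
Proof.
elim: n => [|n IH]; first by rewrite big_geq// addn0 mul1r.
rewrite addnS /= IH big_nat_recr//= mulrA; congr (_ * _).
by rewrite -rmorphM mulrC.
Qed.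

Lemma normc_sqrZ (R : realType) (a : R) (z : R[i]) :
  ComplexField.Normc.normc (a%:C%C * z) ^+ 2 =
  a ^+ 2 * ComplexField.Normc.normc z ^+ 2.
Proof.
rewrite ComplexField.Normc.normcM exprMn; congr (_ * _).
by rewrite /= expr0n/= addr0 sqr_sqrtr// sqr_ge0.
Qed.

Lemma ell2_iter (R : realType) (T : (nat -> R[i]) -> (nat -> R[i]))
    (x : nat -> R[i]) (n : nat) :
  bounded_operator T -> ell2 x -> ell2 (iter n T x).
Proof.
by move=> [_ [M TM]] xl2; elim: n => [//|n IH]; exact: (TM _ IH).1.
Qed.

(** The iterate moves the coordinate [k] to [k + n] and multiplies it by
    [w k * ... * w (k + n - 1)]. *)
Lemma ell2_norm_iter_wshift (R : realType) (w : nat -> R) (x : nat -> R[i])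
    (n : nat) :
  bounded_operator (wshift w) -> ell2 x ->
  series (fun k => hat (fun j => w (k + j)%N) n
                   * ComplexField.Normc.normc (x k) ^+ 2) @ \oo
    --> ell2_norm (iter n (wshift w) x) ^+ 2.
Proof.
move=> bW xl2; have := @ell2_iter _ _ _ n bW xl2; rewrite /ell2 /ell2_norm /=.
set v := fun k => _ => vcvg.
have lim0 : 0 <= limn (series v).
  apply: limr_ge => //; apply: nearW => m.
  by apply: sumr_ge0 => i _; exact: sqr_ge0.
rewrite sqr_sqrtr//; set u := fun k => _.
suff -> : series u = [sequence series v (m + n)%N]_m by rewrite cvg_shiftn.
apply/funext => m; rewrite /series /=.
rewrite [RHS](@big_cat_nat _ _ _ n)//= ?leq_addl//.
rewrite [X in _ = X + _]big_nat_cond.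
rewrite [X in _ = X + _]big1 => [|i /andP[/andP[_ ilt] _]]; last first.
  by rewrite /v iter_wshift_lt// /= expr0n/= addr0 sqrtr0 expr0n.
have -> : \sum_(n <= i < m + n) v i = \sum_(0 <= i < m) v (i + n)%N.
  by rewrite -{1}[n]add0n big_addn addnK.
rewrite add0r; apply: eq_bigr => i _.
by rewrite /v /u iter_wshift_add normc_sqrZ /hat prodrXl.
Qed.

Lemma cvg_series_single (R : realType) (u : nat -> R) (n : nat) :
  (forall k, k != n -> u k = 0) -> series u @ \oo --> u n.
Proof.
move=> u0; apply: cvg_near_cst; exists n.+1 => // m /= nm.
rewrite /series /= (bigD1_seq n)/= ?iota_uniq//; last by rewrite mem_index_iota.
by rewrite big1 ?addr0.
Qed.

Lemma normc_basis (R : realType) (n k : nat) :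
  ComplexField.Normc.normc (@ell2_basis R n k) ^+ 2 = (k == n)%:R.
Proof.
rewrite /ell2_basis; case: eqP => _ /=.
  by rewrite expr0n expr1n addr0 sqrtr1 expr1n.
by rewrite expr0n addr0 sqrtr0 expr0n.
Qed.

Lemma ell2_basis_ell2 (R : realType) (n : nat) : ell2 (@ell2_basis R n).
Proof.
rewrite /ell2 /=; apply/cvg_ex; eexists; apply: (cvg_series_single (n := n)).
by move=> k /negbTE kn; rewrite normc_basis kn.
Qed.

Lemma hat_add (R : realType) (w : nat -> R) (n k : nat) :
  hat w (n + k)%N = hat w k * hat (fun j => w (k + j)%N) n.
Proof.
rewrite /hat addnC (@big_cat_nat _ _ _ k)//= ?leq_addr//; congr (_ * _).
rewrite -{1}[k]add0n big_addn addKn.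
by under eq_bigr do rewrite addnC.
Qed.

(** Evaluated at the first basis vector, the squared norms of the iterates
    are the moments of the shift. *)
Lemma cpd_seq_hat (R : realType) (w : nat -> R) :
  cpd_operator (wshift w) -> cpd_seq (hat w).
Proof.
move=> [bW /(_ _ (@ell2_basis_ell2 R 0%N))]; congr cpd_seq; apply/funext => n.
have := @ell2_norm_iter_wshift _ _ _ n bW (@ell2_basis_ell2 R 0%N).
set u := fun k => _ => /(cvg_lim (@norm_hausdorff _ _)) <-.
have -> : hat w n = u 0%N by rewrite /u normc_basis mulr1.
apply/(cvg_lim (@norm_hausdorff _ _))/cvg_series_single => k /negbTE k0.
by rewrite /u normc_basis k0 mulr0.
Qed.

Lemma hat_gt0 (R : realType) (w : nat -> R) (n : nat) :
  (forall k, 0 < w k) -> 0 < hat w n.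
Proof. by move=> w0; rewrite prodr_gt0// => i _; rewrite exprn_gt0. Qed.

(** The squared norms of the iterates at [h] are a limit of nonnegative
    combinations of the sequences [hat w (n + k)], the weight of the k-th one
    being that of the k-th coordinate of [h], and conditional positivity passes
    to such limits. *)
Lemma cpd_operator_wshift (R : realType) (w : nat -> R) :
  (forall k, 0 < w k) -> (exists M, forall k, w k <= M) ->
  (forall k, cpd_seq (fun n => hat w (n + k)%N)) -> cpd_operator (wshift w).
Proof.
move=> w0 wM wcpd; have bW := wshift_bounded w0 wM; split=> // h hl2.
apply/cpd_seq_riesz => p p1; set q := p ^+ 2.
have seriesE N : \sum_(k < N) ComplexField.Normc.normc (h k) ^+ 2 / hat w k
      * riesz (fun n => hat w (n + k)%N) q =
    \sum_(i < size q) series (fun k => hat (fun j => w (k + j)%N) i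
      * ComplexField.Normc.normc (h k) ^+ 2) N * q`_i.
  under eq_bigr do rewrite mulr_sumr.
  rewrite exchange_big/=; apply: eq_bigr => i _.
  rewrite /series /= big_mkord mulr_suml; apply: eq_bigr => k _.
  rewrite hat_add; have := hat_gt0 k w0; set y := hat w k => y0.
  by field; rewrite gt_eqF.
have : (fun N => \sum_(k < N) ComplexField.Normc.normc (h k) ^+ 2 / hat w k
      * riesz (fun n => hat w (n + k)%N) q) @ \oo -->
    riesz (fun n => ell2_norm (iter n (wshift w) h) ^+ 2) q.
  under eq_cvg do rewrite seriesE.
  apply: cvg_big => [|i _]; first exact: add_continuous.
  by apply: cvgMr_tmp; exact: ell2_norm_iter_wshift.
move=> /[dup] rcvg /(cvg_lim (@norm_hausdorff _ _)) <-.
apply: limr_ge; first by apply/cvg_ex; eexists; exact: rcvg.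
apply: nearW => N; apply: sumr_ge0 => k _.
apply: mulr_ge0; first by rewrite divr_ge0 ?sqr_ge0// ltW// hat_gt0.
by have /cpd_seq_riesz := wcpd k; exact.
Qed.

(** * Moments of compactly supported measures *)

(** The only discontinuity is at [0], where the value is [+oo]. *)
Lemma measurable_inve (R : realType) :
  measurable_fun [set: measurableTypeR R] (fun x : R => (x%:E^-1)%E).
Proof.
under eq_fun do rewrite inver.
apply: measurable_fun_if => //.
- exact: measurable_fun_eqr.
- apply/measurable_EFinP; rewrite setTI.
  apply: open_continuous_measurable_fun.
    rewrite (_ : _ @^-1` _ = ~` [set 0]); last first.
      by apply/seteqP; split=> x /= => [/eqP|/eqP/negbTE].
    by apply: closed_openC; exact: closed_eq.
  by move=> x; rewrite inE /= => /negbT x0; exact: inv_continuous.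
Qed.

Lemma measurable_invX (R : realType) (k : nat) (D : set R) :
  measurable_fun (D : set (measurableTypeR R))
    (fun x : R => ((x ^+ k)%:E^-1)%E).
Proof.
apply: measurable_funTS.
by apply: (measurableT_comp (@measurable_inve R)); exact: measurable_funX.
Qed.

Lemma invX_ge0 (R : realType) (k : nat) (x : R) :
  0 <= x -> (0 <= (x ^+ k)%:E^-1)%E.
Proof. by move=> x0; rewrite inve_ge0 lee_fin exprn_ge0. Qed.

Lemma measurable_EFin_horner (R : realType) (p : {poly R}) (D : set R) :
  measurable_fun (D : set (measurableTypeR R)) (fun x : R => (p.[x])%:E).
Proof.
apply/measurable_EFinP; apply: measurable_funTS.
by apply: continuous_measurable_fun; exact: continuous_horner.
Qed.

(** The support clause of [scalar_triplet], for an arbitrary set function. *)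
Definition compactly_supported (R : realType)
    (mu : set (measurableTypeR R) -> \bar R) : Prop :=
  exists K : set R, [/\ compact K, K `<=` `[0, +oo[ & mu (~` K) = 0%E].

Lemma compactly_supported_itv (R : realType)
    (mu : {measure set (measurableTypeR R) -> \bar R}) :
  compactly_supported mu -> exists2 M : R, 0 < M & mu (~` `[0, M]) = 0%E.
Proof.
move=> [K [cK K0 muK]].
have [M [_ Mub]] := compact_bounded cK.
exists (`|M| + 1); first by rewrite ltr_wpDl.
apply: (subset_measure0 _ _ _ muK).
- exact: measurableC.
- by apply: measurableC; exact: compact_measurable.
- apply: subsetC => x Kx; have := K0 _ Kx; rewrite /= !in_itv/= andbT => ->/=.
  apply: le_trans (ler_norm _) (Mub _ _ _ Kx).
  by rewrite ltr_pwDr// ler_norm.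
Qed.

Lemma integral_support (R : realType)
    (mu : {measure set (measurableTypeR R) -> \bar R}) (M : R)
    (f : R -> \bar R) :
  mu (~` `[0, M]) = 0%E ->
  measurable_fun (`[0, +oo[ : set (measurableTypeR R)) f ->
  (forall x : R, 0 <= x -> (0 <= f x)%E) ->
  (\int[mu]_(x in `[0%R, +oo[) f x = \int[mu]_(x in `[0%R, M]) f x)%E.
Proof.
move=> muM mf f0.
rewrite (@ge0_negligible_integral _ _ _ mu _ (~` `[0, M]))//; last 2 first.
- exact: measurableC.
- by move=> x /=; rewrite in_itv/= andbT; exact: f0.
congr (integral _ _ _); rewrite setDE setCK; apply/seteqP; split=> x /=.
  by move=> [].
by rewrite !in_itv/= => /andP[-> ->].
Qed.

Lemma integrable_horner (R : realType)
    (mu : {finite_measure set (measurableTypeR R) -> \bar R}) (p : {poly R}) :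
  compactly_supported mu ->
  mu.-integrable `[0, +oo[ (fun x : R => (p.[x])%:E).
Proof.
move=> /compactly_supported_itv[M M0 muM].
have mN : measurable (~` `[0, M] : set (measurableTypeR R)).
  exact: measurableC.
rewrite (negligible_integrable mN)//; last exact: measurable_EFin_horner.
have mI : measurable (`[0%R, +oo[ `\` ~` `[0, M] : set (measurableTypeR R)).
  exact: measurableD.
apply: measurable_bounded_integrable => //.
- by apply: (le_lt_trans (le_measure _ _ _ (@subsetT _ _)));
    rewrite ?inE// ltey_eq fin_num_measure.
- apply/measurable_EFinP; exact: measurable_EFin_horner.
have : compact (horner p @` `[0, M]).
  apply: continuous_compact; last exact: segment_compact.
  by apply: continuous_subspaceT; exact: continuous_horner.
move=> /compact_bounded[N [Nr Nub]]; exists N; split=> // y Ny.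
move=> x [_ /contrapT Ix].
by apply: Nub => //; exists x.
Qed.

Definition moment (R : realType)
    (mu : {finite_measure set (measurableTypeR R) -> \bar R}) (m : nat) : R :=
  fine (\int[mu]_(x in `[0%R, +oo[) (x ^+ m)%:E)%E.

(** On a moment sequence the functional is integration of the polynomial. *)
Lemma riesz_moment (R : realType)
    (mu : {finite_measure set (measurableTypeR R) -> \bar R}) (p : {poly R}) :
  compactly_supported mu ->
  (riesz (moment mu) p)%:E = (\int[mu]_(x in `[0%R, +oo[) (p.[x])%:E)%E.
Proof.
move=> cmu.
have iX a i : mu.-integrable `[0, +oo[ (fun x : R => (a * x ^+ i)%:E).
  have := integrable_horner (a *: 'X^i) cmu.
  by under [X in _.-integrable _ X]eq_fun do rewrite hornerZ hornerXn.
have iX1 i : mu.-integrable `[0, +oo[ (fun x : R => (x ^+ i)%:E).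
  by have := iX 1 i; under [X in _.-integrable _ X]eq_fun do rewrite mul1r.
under eq_integral do rewrite horner_coef -sumEFin.
rewrite integral_sum//=.
rewrite -sumEFin; apply: eq_bigr => i _.
under eq_integral do rewrite EFinM.
rewrite integralZl//.
by rewrite EFinM muleC fineK// integrable_fin_num.
Qed.

Lemma momentE (R : realType)
    (mu : {finite_measure set (measurableTypeR R) -> \bar R}) (m : nat) :
  compactly_supported mu ->
  (moment mu m)%:E = (\int[mu]_(x in `[0%R, +oo[) (x ^+ m)%:E)%E.
Proof.
move=> cmu; rewrite -(rieszXn (moment mu)) riesz_moment//.
by under eq_integral do rewrite hornerXn.
Qed.

(** * Measures with a density or an additional atom *)

Lemma finite_measure_of d (T : measurableType d) (R : realType)
    (k : {measure set T -> \bar R}) :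
  fin_num_fun k ->
  exists kf : {finite_measure set T -> \bar R}, forall A, kf A = k A.
Proof.
move=> kfin; pose k' A := k A.
pose ism := isMeasure.Build _ _ _ k' (measure0 k) (measure_ge0 k)
  (@measure_semi_sigma_additive _ _ _ k).
pose km : {measure set T -> \bar R} := HB.pack k' ism.
pose isf := Measure_isFinite.Build _ _ _ km kfin.
pose kf : {finite_measure set T -> \bar R} := HB.pack k' ism isf.
by exists kf.
Qed.

Lemma exists_density d (T : measurableType d) (R : realType)
    (mu : {finite_measure set T -> \bar R}) (f : T -> \bar R) :
  (forall x, 0 <= f x)%E -> mu.-integrable setT f ->
  exists k : {finite_measure set T -> \bar R},
    forall A, k A = (\int[mu]_(x in A) f x)%E.
Proof.
move=> f0 fint; have mf := measurable_int _ fint.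
pose k A := (\int[mu]_(x in A) f x)%E.
have k0 : k set0 = 0%E by rewrite /k integral_set0.
have kge0 A : (0 <= k A)%E by apply: integral_ge0 => x _; exact: f0.
have ksig : semi_sigma_additive k.
  move=> F mF tF mUF; rewrite /k ge0_integral_bigcup//; last first.
    exact: measurable_funTS.
  apply: is_cvg_ereal_nneg_natsum_cond => n _ _; exact: kge0.
pose ism := isMeasure.Build _ _ _ k k0 kge0 ksig.
pose km : {measure set T -> \bar R} := HB.pack k ism.
have kfin : fin_num_fun km.
  move=> A mA; apply: integrable_fin_num => //.
  exact: integrableS fint.
have [kf kfE] := @finite_measure_of _ _ _ km kfin.
by exists kf => A; rewrite kfE.
Qed.

(** Both [f] and the Radon-Nikodym derivative of [k] have integral [k A] over
    [A], so they agree almost everywhere, and integration against [k] is integration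
    against its derivative. *)
Lemma integral_density d (T : measurableType d) (R : realType)
    (mu k : {finite_measure set T -> \bar R}) (f : T -> \bar R)
    (D : set T) (g : T -> \bar R) :
  mu.-integrable setT f ->
  (forall A, measurable A -> k A = \int[mu]_(x in A) f x)%E ->
  measurable D -> k.-integrable D g ->
  (\int[k]_(x in D) g x = \int[mu]_(x in D) (g x * f x))%E.
Proof.
move=> fint kE mD gint.
have kmu : k `<< mu.
  apply/null_content_dominatesP => A mA muA.
  rewrite kE// null_set_integral//.
  exact: measurable_funTS (measurable_int _ fint).
have mf : measurable_fun D f by exact: measurable_funTS (measurable_int _ fint).
have mg := measurable_int _ gint.
rewrite -(Radon_Nikodym_change_of_variables kmu)//.
have RNint :
    mu.-integrable setT (Radon_Nikodym (charge_of_finite_measure k) mu).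
  exact: Radon_Nikodym_integrable.
have mRN : measurable_fun D (Radon_Nikodym (charge_of_finite_measure k) mu).
  exact: measurable_funTS (measurable_int _ RNint).
apply: ae_eq_integral => //; [exact: emeasurable_funM..|].
apply: ae_eqe_mul2l; apply: integral_ae_eq => //.
  exact: integrableS RNint.
move=> E ED mE; rewrite -Radon_Nikodym_integral//=.
exact: kE.
Qed.

(** The integrand is [+oo] at [0]. *)
Lemma int_invX_lty_null (R : realType)
    (mu : {finite_measure set (measurableTypeR R) -> \bar R}) (n : nat) :
  (0 < n)%N -> (int_invX mu n `[0%R, +oo[ < +oo)%E -> mu [set 0] = 0%E.
Proof.
move=> n0; rewrite /int_invX => fin; apply/eqP; apply: contraTT fin => mu0.
rewrite -leNgt.
have <- : (\int[mu]_(x in [set 0%R]) ((x ^+ n)%:E)^-1)%E = +oo%E.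
  rewrite (eq_integral (cst +oo%E)); last first.
    by move=> x; rewrite inE /= => ->; rewrite expr0n gtn_eqF// inve0.
  by rewrite integral_cst// gt0_mulye// lt0e mu0/=.
apply: ge0_subset_integral => //.
- exact: measurable_invX.
- by move=> x /=; rewrite in_itv/= andbT; exact: invX_ge0.
- by move=> x /= ->; rewrite in_itv/= lexx.
Qed.

Lemma integral_punctured (R : realType)
    (mu : {finite_measure set (measurableTypeR R) -> \bar R})
    (f : R -> \bar R) :
  mu [set 0] = 0%E ->
  measurable_fun (`[0, +oo[ : set (measurableTypeR R)) f ->
  (forall x : R, 0 <= x -> (0 <= f x)%E) ->
  (\int[mu]_(x in `[0%R, +oo[) f x = \int[mu]_(x in `]0%R, +oo[) f x)%E.
Proof.
move=> mu0 mf f0; rewrite (@ge0_negligible_integral _ _ _ mu _ [set 0])//.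
  congr (integral _ _ _); apply/seteqP; split=> x /=; rewrite !in_itv/= !andbT.
    by move=> [x0 /eqP xn0]; rewrite lt_neqAle eq_sym xn0.
  by move=> x0; split; [exact: ltW|apply/eqP; rewrite gt_eqF].
by move=> x /=; rewrite in_itv/= andbT; exact: f0.
Qed.

(** The measure with density [x^-n] with respect to [mu] shifts moments by [n]:
    its moments of rank at least [n] are those of [mu], and the lower ones are
    integrals of negative powers.  The latter uses that [mu] has no mass at [0],
    where [x ^+ m * x^-n] and [x^-(n - m)] differ. *)
Lemma inv_power_measure (R : realType)
    (mu : {finite_measure set (measurableTypeR R) -> \bar R}) (n : nat) :
  (0 < n)%N -> compactly_supported mu ->
  (int_invX mu n `[0%R, +oo[ < +oo)%E ->
  exists k : {finite_measure set (measurableTypeR R) -> \bar R},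
    [/\ compactly_supported k,
        (forall A : set R, measurable (A : set (measurableTypeR R)) ->
           A `<=` `[0, +oo[ -> k A = int_invX mu n A),
        (forall p : {poly R}, (riesz (moment k) p)%:E =
           \int[mu]_(x in `[0%R, +oo[) ((p.[x])%:E * (x ^+ n)%:E^-1))%E,
        (forall m, (m < n)%N ->
           (moment k m)%:E = int_invX mu (n - m) `[0%R, +oo[) &
        (forall m, moment k (m + n) = moment mu m)].
Proof.
move=> n0 cmu fin; have mu0 := int_invX_lty_null n0 fin.
pose inv (x : R) := ((x ^+ n)%:E^-1)%E.
pose f := inv \_ `[0, +oo[.
have f0 x : (0 <= f x)%E.
  rewrite /f patchE; case: ifPn => //; rewrite inE/= in_itv/= andbT => x0.
  exact: invX_ge0.
have minv (A : set R) : measurable_fun (A : set (measurableTypeR R)) inv.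
  exact: measurable_invX.
have fint : mu.-integrable setT f.
  apply/integrableP; split.
    by apply/(measurable_restrictT _ _).1 => //; exact: minv.
  under eq_integral do rewrite gee0_abs//.
  by rewrite -integral_mkcond.
have [k kE] := @exists_density _ (measurableTypeR R) R mu f f0 fint.
have kDE A : A `<=` `[0, +oo[ -> k A = int_invX mu n A.
  move=> AD; rewrite kE; apply: eq_integral => x; rewrite inE => /AD xD.
  by rewrite /f patchE mem_set.
have ck : compactly_supported k.
  have [K [cK K0 muK]] := cmu; exists K; split => //.
  rewrite kE null_set_integral//.
    by apply: measurableC; exact: compact_measurable.
  exact: measurable_funTS (measurable_int _ fint).
have kint (p : {poly R}) : (riesz (moment k) p)%:E =
    (\int[mu]_(x in `[0%R, +oo[) ((p.[x])%:E * inv x))%E.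
  rewrite riesz_moment//.
  rewrite (@integral_density _ (measurableTypeR R) R mu k f)//; last first.
    exact: integrable_horner.
  by apply: eq_integral => x xD; rewrite /f patchE xD.
have kmom m : (moment k m)%:E =
    (\int[mu]_(x in `]0%R, +oo[) ((x ^+ m)%:E * inv x))%E.
  rewrite -rieszXn kint; under eq_integral do rewrite hornerXn.
  apply: integral_punctured => //.
    apply: emeasurable_funM; last exact: minv.
    by apply/measurable_EFinP; exact: measurable_funX.
  by move=> x x0; apply: mule_ge0; [rewrite lee_fin exprn_ge0|exact: invX_ge0].
exists k; split => //.
- by move=> A mA; exact: kDE.
- move=> m mn; rewrite kmom /int_invX integral_punctured//; last 2 first.
  + exact: measurable_invX.
  + by move=> x; exact: invX_ge0.
  apply: eq_integral => x; rewrite inE/= in_itv/= andbT => x0.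
  rewrite /inv !inver !expf_eq0 gt_eqF// !andbF -EFinM; congr EFin.
  by rewrite -(subnK (ltnW mn)) exprD addnK; field; rewrite !expf_neq0 ?gt_eqF.
- move=> m; apply: EFin_inj; rewrite kmom -(rieszXn (moment mu)) riesz_moment//.
  rewrite [RHS]integral_punctured//; last 2 first.
  + exact: measurable_EFin_horner.
  + by move=> x x0; rewrite hornerXn lee_fin exprn_ge0.
  apply: eq_integral => x; rewrite inE/= in_itv/= andbT => x0.
  rewrite hornerXn /inv inver expf_eq0 gt_eqF// andbF -EFinM; congr EFin.
  by rewrite exprD mulfK// expf_neq0 ?gt_eqF.
Qed.

Lemma add_dirac d (T : measurableType d) (R : realType)
    (nu : {finite_measure set T -> \bar R}) (a : T) (c : R) :
  0 <= c ->
  exists mu : {finite_measure set T -> \bar R},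
    (forall A, mu A = nu A + c%:E * \d_a A)%E /\
    (forall (D : set T) (f : T -> \bar R), measurable D -> D a ->
       measurable_fun D f -> (forall x, D x -> (0 <= f x)%E) ->
       (\int[mu]_(x in D) f x = \int[nu]_(x in D) f x + c%:E * f a)%E).
Proof.
move=> c0; pose k := measure_add nu (mscale (NngNum c0) (dirac a)).
have kE A : k A = (nu A + c%:E * \d_a A)%E by rewrite /k measure_addE.
have kfin : fin_num_fun k.
  by move=> A mA; rewrite kE fin_numD fin_num_measure// diracE.
have [mu muE] := finite_measure_of kfin.
exists mu; split=> [A|D f mD Da mf f0]; first by rewrite muE; exact: kE.
rewrite (@eq_measure_integral _ _ _ _ k); last by move=> A _ _; exact: muE.
rewrite ge0_integral_measure_add//; congr (_ + _)%E.
rewrite ge0_integral_mscale//= integral_dirac// diracE mem_set//.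
by rewrite mul1e.
Qed.

(** Used at [a = 1], where the atom encodes the quadratic term of a triplet, and
    at [a = 0], for the atom of the measure of an extension. *)
Lemma add_atom (R : realType)
    (nu : {finite_measure set (measurableTypeR R) -> \bar R}) (a c : R) :
  compactly_supported nu -> 0 <= a -> 0 <= c ->
  exists mu : {finite_measure set (measurableTypeR R) -> \bar R},
    [/\ compactly_supported mu,
        (forall A, mu A = nu A + c%:E * \d_a A)%E,
        (forall m, moment mu m = moment nu m + c * a ^+ m) &
        (forall k, int_invX mu k `[0%R, +oo[ =
           int_invX nu k `[0%R, +oo[ + c%:E * (a ^+ k)%:E^-1)%E].
Proof.
move=> cnu a0 c0.
have [mu [muE muI]] := @add_dirac _ (measurableTypeR R) R nu a c c0.
have Da : `[0%R, +oo[%classic a by rewrite /= in_itv/= a0.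
have cmu : compactly_supported mu.
  have [M M0 nuM] := compactly_supported_itv cnu.
  exists (`[0, Num.max a M])%classic; split; first exact: segment_compact.
    by move=> x /=; rewrite !in_itv/= andbT => /andP[].
  rewrite muE (@subset_measure0 _ _ _ nu _ (~` `[0, M]))//.
  - rewrite add0e diracE memNset ?mule0//.
    by move=> /=; rewrite in_itv/= a0 le_max lexx.
  - exact: measurableC.
  - exact: measurableC.
  - apply: subsetC => x /=; rewrite !in_itv/= => /andP[-> xM].
    by rewrite le_max xM orbT.
exists mu; split=> // [m|k].
- apply: EFin_inj; rewrite EFinD !momentE// muI//.
  + by apply/measurable_EFinP; exact: measurable_funX.
  + by move=> x /=; rewrite in_itv/= andbT lee_fin => x0; exact: exprn_ge0.
- rewrite /int_invX muI//; first exact: measurable_invX.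
  by move=> x /=; rewrite in_itv/= andbT; exact: invX_ge0.
Qed.

Lemma scale_measure (R : realType)
    (k : {finite_measure set (measurableTypeR R) -> \bar R}) (a : R) :
  compactly_supported k -> 0 <= a ->
  exists mu : {finite_measure set (measurableTypeR R) -> \bar R},
    [/\ compactly_supported mu, (forall A, mu A = a%:E * k A)%E &
        (forall m, moment mu m = a * moment k m)].
Proof.
move=> ck a0; exists (mscale (NngNum a0) k); split=> //.
- have [K [cK K0 kK]] := ck; exists K; split=> //.
  by rewrite /= /mscale/= kK mule0.
- move=> m; rewrite {1}/moment ge0_integral_mscale//=.
  + by rewrite -momentE.
  + by apply/measurable_EFinP; exact: measurable_funX.
  + by move=> x /=; rewrite in_itv/= andbT lee_fin => x0; exact: exprn_ge0.
Qed.

(** * Backward continuation of moment sequences *)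

(** A partial sum of the geometric series of ratio [1 - x / M] for [1 / x]; it
    increases to [1 / x] when [0 <= x <= M]. *)
Definition trunc_inv (R : realType) (M : R) (j : nat) : {poly R} :=
  M^-1 *: \sum_(i < j) (1 - M^-1 *: 'X) ^+ i.

Lemma trunc_invE (R : realType) (M x : R) (j : nat) :
  (trunc_inv M j).[x] = M^-1 * \sum_(i < j) (1 - x / M) ^+ i.
Proof.
rewrite hornerZ horner_sum; congr (_ * _); apply: eq_bigr => i _.
by rewrite !hornerE mulrC.
Qed.

Lemma mul_trunc_inv (R : realType) (M x : R) (j : nat) :
  x * (trunc_inv M j).[x] = 1 - (1 - x / M) ^+ j.
Proof.
rewrite trunc_invE -[RHS]opprB subrX1; ring.
Qed.

Lemma trunc_inv_itv (R : realType) (M x : R) : 0 < M -> 0 <= x <= M ->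
  0 <= 1 - x / M <= 1.
Proof.
move=> M0 /andP[x0 xM].
by rewrite subr_ge0 ler_pdivrMr// mul1r xM lerBlDr lerDl divr_ge0// ltW.
Qed.

Lemma trunc_inv_ge0 (R : realType) (M x : R) (j : nat) : 0 < M ->
  0 <= x <= M -> 0 <= (trunc_inv M j).[x].
Proof.
move=> M0 xM; rewrite trunc_invE mulr_ge0 ?invr_ge0 ?(ltW M0)//.
have /andP[r0 _] := trunc_inv_itv M0 xM.
by apply: sumr_ge0 => i _; rewrite exprn_ge0.
Qed.

Lemma trunc_inv_nd (R : realType) (M x : R) : 0 < M -> 0 <= x <= M ->
  {homo (fun j => (trunc_inv M j).[x]) : i j / (i <= j)%N >-> i <= j}.
Proof.
move=> M0 xM; apply/nondecreasing_seqP => j.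
have /andP[r0 _] := trunc_inv_itv M0 xM.
rewrite !trunc_invE ler_wpM2l ?invr_ge0 ?(ltW M0)// big_ord_recr/=.
by rewrite lerDl exprn_ge0.
Qed.

Lemma mul_trunc_inv_le1 (R : realType) (M x : R) (j : nat) : 0 < M ->
  0 <= x <= M -> 0 <= x * (trunc_inv M j).[x] <= 1.
Proof.
move=> M0 xM; have /andP[r0 r1] := trunc_inv_itv M0 xM.
by rewrite mul_trunc_inv subr_ge0 exprn_ile1//= lerBlDr lerDl exprn_ge0.
Qed.

(** The case [x = 0] is what makes the limit catch the mass at [0]: there the
    approximation is [j / M], which tends to [+oo]. *)
Lemma cvg_trunc_invX (R : realType) (M x : R) (n : nat) : (0 < n)%N ->
  0 < M -> 0 <= x <= M ->
  ((trunc_inv M j).[x] ^+ n)%:E @[j --> \oo] --> ((x ^+ n)%:E^-1)%E.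
Proof.
move=> n0 M0 /[dup] xM /andP[]; rewrite le_eqVlt => /predU1P[<- _|x0 xleM].
  rewrite expr0n gtn_eqF// inve0; apply/cvgeryP.
  have vE j : (trunc_inv M j).[0] = M^-1 * j%:R.
    rewrite trunc_invE mul0r subr0; under eq_bigr do rewrite expr1n.
    by rewrite sumr_const card_ord.
  under eq_cvg do rewrite vE.
  apply/cvgryPge => A; near=> j.
  have Aj : Num.max A 1 <= M^-1 * j%:R.
    by rewrite mulrC ler_pdivlMr//; near: j; exact: nbhs_infty_ger.
  move: Aj; rewrite ge_max => /andP[Aj j1].
  by apply: (le_trans Aj); rewrite ler_eXnr.
rewrite inver expf_eq0 gt_eqF// andbF.
apply: cvg_EFin; first exact: nearW.
have vE j : (trunc_inv M j).[x] = (1 - (1 - x / M) ^+ j) / x.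
  by rewrite -mul_trunc_inv; field; rewrite gt_eqF.
rewrite (_ : fine \o _ =
    fun j => ((1 - (1 - x / M) ^+ j) / x) ^+ n); last first.
  by apply/funext => j /=; rewrite vE.
have -> : (x ^+ n)^-1 = ((1 - 0) / x) ^+ n by rewrite subr0 mul1r exprVn.
apply: (@continuous_cvg _ _ _ _ _ (fun j => (1 - (1 - x / M) ^+ j) / x)
  (fun y : R => y ^+ n)); first exact: exprn_continuous.
apply: cvgMr_tmp; apply: cvgB; first exact: cvg_cst.
apply: cvg_expr; rewrite ger0_norm.
  by rewrite ltrBlDr ltrDl divr_gt0.
by have /andP[] := trunc_inv_itv M0 xM.
Unshelve. all: by end_near. Qed.

(** Positivity on [p * (1 - u ^+ n)], where [u = 'X * v] and [v] is the [j]-th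
    approximation of [1 / x], bounds the value at [p ^+ 2] below by the value at
    [p ^+ 2 * (2 * u ^+ n - u ^+ (2 * n))], a multiple of ['X^n].  The latter is
    the integral of [p ^+ 2 * v ^+ n * (2 - u ^+ n)], which is at least that of
    [p ^+ 2 * v ^+ n] because [0 <= u <= 1] on the support.  Then [j] goes to
    infinity by monotone convergence. *)
Lemma riesz_sqr_ge (R : realType)
    (mu : {finite_measure set (measurableTypeR R) -> \bar R}) (n : nat)
    (s : nat -> R) (p : {poly R}) :
  (0 < n)%N -> compactly_supported mu ->
  (forall q : {poly R}, 0 <= riesz s (q ^+ 2)) ->
  (forall m, s (m + n)%N = moment mu m) ->
  (\int[mu]_(x in `[0%R, +oo[) (((p ^+ 2).[x])%:E * (x ^+ n)%:E^-1)
    <= (riesz s (p ^+ 2))%:E)%E.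
Proof.
move=> n0 cmu spos smom.
have [M M0 muM] := compactly_supported_itv cmu.
have p20 (x : R) : 0 <= (p ^+ 2).[x] by rewrite horner_exp sqr_ge0.
have mp A : measurable_fun (A : set (measurableTypeR R))
    (fun x : R => ((p ^+ 2).[x])%:E) by exact: measurable_EFin_horner.
rewrite (integral_support muM); last 2 first.
- by apply: emeasurable_funM => //; exact: measurable_invX.
- by move=> x x0; apply: mule_ge0; [rewrite lee_fin|exact: invX_ge0].
pose g j (x : R) := (((p ^+ 2).[x])%:E * ((trunc_inv M j).[x] ^+ n)%:E)%E.
have itvP (x : R) : `[0, M]%classic x -> 0 <= x <= M by rewrite /= in_itv.
have mg j : measurable_fun (`[0, M] : set (measurableTypeR R)) (g j).
  apply: emeasurable_funM => //; apply/measurable_EFinP; apply: measurable_funX.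
  by apply/measurable_EFinP; exact: measurable_EFin_horner.
have g0 j x : `[0, M]%classic x -> (0 <= g j x)%E.
  move=> /itvP xM; apply: mule_ge0; rewrite lee_fin//.
  by rewrite exprn_ge0// trunc_inv_ge0.
have gcvg : (\int[mu]_(x in `[0%R, M]) g j x)%E @[j --> \oo] -->
    (\int[mu]_(x in `[0%R, M]) (((p ^+ 2).[x])%:E * (x ^+ n)%:E^-1))%E.
  rewrite (_ : integral _ _ _ = \int[mu]_(x in `[0%R, M]) limn (g ^~ x))%E.
    apply: cvg_monotone_convergence => // x /itvP xM i j ij.
    apply: lee_wpmul2l; rewrite lee_fin//.
    by rewrite lerXn2r ?nnegrE ?trunc_inv_ge0// trunc_inv_nd.
  apply: eq_integral => x; rewrite inE => /itvP xM.
  apply/esym/cvg_lim => //; apply: cvgeZl => //.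
  exact: cvg_trunc_invX.
apply: cvge_le gcvg; apply: nearW => j.
pose v := trunc_inv M j; pose r := p ^+ 2 * v ^+ n * (2 - ('X * v) ^+ n).
(* [u = 'X * v] is divisible by ['X]: the cross term is a multiple of ['X^n]. *)
have rp : riesz s (p ^+ 2) = riesz (moment mu) r
    + riesz s ((p * (1 - ('X * v) ^+ n)) ^+ 2).
  have -> : moment mu = fun m => s (m + n)%N by apply/funext.
  rewrite -rieszXnM -linearD/=; congr (riesz s _).
  by rewrite /r exprMn; ring.
(* On the support, [2 - u ^+ n >= 1]. *)
apply: (@le_trans _ _ (riesz (moment mu) r)%:E); last first.
  by rewrite lee_fin rp lerDl.
have mN : measurable (~` `[0, M] : set (measurableTypeR R)).
  exact: measurableC.
have DN : `[0, +oo[%classic `\` ~` `[0, M]%classic = `[0, M]%classic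
    :> set (measurableTypeR R).
  rewrite setDE setCK; apply/seteqP; split=> x /=; first by move=> [].
  by rewrite !in_itv/= => /andP[-> ->].
rewrite riesz_moment//.
rewrite [leRHS](@negligible_integral _ (measurableTypeR R) R mu _
  (~` `[0, M]))//.
  rewrite DN; apply: ge0_le_integral => //.
  - by move=> x Ix; exact: g0.
  - exact: measurable_EFin_horner.
  move=> x /itvP xM; rewrite /g -EFinM lee_fin /r -/v.
  rewrite [leRHS]hornerM (hornerM (p ^+ 2)) (horner_exp v) -/v.
  rewrite ler_peMr ?mulr_ge0 ?exprn_ge0 ?trunc_inv_ge0//.
  have /andP[u0 u1] := mul_trunc_inv_le1 j M0 xM.
  have h2 : (2 : {poly R}).[x] = 2 by rewrite !hornerE.
  rewrite hornerD hornerN horner_exp (hornerM _ v) hornerX h2 lerBrDr -lerBrDl;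
  apply: (le_trans (exprn_ile1 n u0 u1)); lra.
exact: integrable_horner.
Qed.

(** Descending induction: once [s (2 * m) = 0], the form at [1 + a *: 'X^m] is
    the affine function [s 0 + 2 * a * s m] of [a], which is nonnegative for all
    [a] only if [s m = 0]. *)
Lemma riesz_psd_tail0 (R : realType) (s : nat -> R) (n : nat) :
  (forall q : {poly R}, 0 <= riesz s (q ^+ 2)) ->
  (forall m, (n <= m)%N -> s m = 0) -> forall m, (0 < m)%N -> s m = 0.
Proof.
move=> spos stail.
suff H d m : (n <= m + d)%N -> (0 < m)%N -> s m = 0.
  by move=> m; apply: (H n); rewrite leq_addl.
elim: d m => [|d IH] m; first by rewrite addn0 => /stail.
move=> nmd m0; have s2m : s (m + m)%N = 0.
  by apply: IH; rewrite ?addn_gt0 ?m0//; apply: leq_trans nmd _;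
    rewrite addnS -addSn leq_add2r -addn1 leq_add2l.
have pos a : 0 <= s 0%N + 2 * a * s m.
  have := spos (1 + a *: 'X^m).
  have -> : (1 + a *: 'X^m) ^+ 2 =
      'X^0 + (2 * a) *: 'X^m + (a ^+ 2) *: 'X^(m + m) :> {poly R}.
    by rewrite expr0 exprD -!mul_polyC !polyCM; ring.
  by rewrite !linearD/= !linearZ/= !rieszXn s2m mulr0 addr0.
(* At this value of [a] the affine function is [-1]. *)
apply/eqP; apply: contraT => sm0; have := pos (- (s 0%N + 1) / (2 * s m)).
have -> : 2 * (- (s 0%N + 1) / (2 * s m)) * s m = - (s 0%N + 1) by field.
by lra.
Qed.

(** The measure [x^-n * mu] has the moments of rank at least [n] prescribed by
    [s], and by [riesz_sqr_ge] its moments can be subtracted from [s] without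
    losing positivity.  The difference has a zero tail, so only an excess at rank
    [0] can remain; it is the mass of an atom at [0]. *)
Lemma backward_moments (R : realType)
    (mu : {finite_measure set (measurableTypeR R) -> \bar R}) (n : nat)
    (s : nat -> R) :
  (0 < n)%N -> compactly_supported mu ->
  (forall q : {poly R}, 0 <= riesz s (q ^+ 2)) ->
  (forall m, s (m + n)%N = moment mu m) ->
  (int_invX mu n `[0%R, +oo[ <= (s 0)%:E)%E /\
  (forall m, (0 < m < n)%N -> (s m)%:E = int_invX mu (n - m) `[0%R, +oo[).
Proof.
move=> n0 cmu spos smom.
have s0 : (int_invX mu n `[0%R, +oo[ <= (s 0)%:E)%E.
  have := riesz_sqr_ge 1 n0 cmu spos smom.
  rewrite expr1n -[X in riesz s X](expr0 'X) rieszXn.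
  by under eq_integral do rewrite hornerC mul1e.
split=> // m /andP[m0 mn].
have [k [_ _ kint klt kge]] :=
  inv_power_measure n0 cmu (le_lt_trans s0 (ltry _)).
rewrite -klt//; congr EFin; apply/eqP; rewrite -subr_eq0; apply/eqP.
apply: (@riesz_psd_tail0 _ (fun i => s i - moment k i) n) => // [q|i ni].
  have -> : riesz (fun i => s i - moment k i) (q ^+ 2) =
      riesz s (q ^+ 2) - riesz (moment k) (q ^+ 2).
    by rewrite /riesz -sumrB; apply: eq_bigr => i _; rewrite mulrBl.
  by rewrite subr_ge0 -lee_fin kint; exact: riesz_sqr_ge.
by rewrite -(subnK ni) smom kge subrr.
Qed.

(** * Scalar representing triplets *)

(** Truncated subtraction makes this hold beyond the degree as well. *)
Lemma coef_Q (R : realType) (n i : nat) : (Q R n)`_i = (n - i - 1)%:R.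
Proof.
rewrite coef_poly; case: ltnP => // ni.
by have -> : (n - i - 1 = 0)%N by lia.
Qed.

Lemma diff2_Q (R : realType) (m : nat) :
  Q R m.+2 - 2 *: Q R m.+1 + Q R m = 'X^m.
Proof.
apply/polyP => i; rewrite !coefD coefN coefZ !coef_Q coefXn.
have [im|mi|->] := ltngtP i m.
- have -> : (m.+2 - i - 1 = (m - i - 1) + 2)%N by lia.
  have -> : (m.+1 - i - 1 = (m - i - 1) + 1)%N by lia.
  by rewrite !natrD /=; ring.
- have -> : (m.+2 - i - 1 = 0)%N by lia.
  have -> : (m.+1 - i - 1 = 0)%N by lia.
  have -> : (m - i - 1 = 0)%N by lia.
  by rewrite /=; ring.
- have -> : (m.+2 - m - 1 = 1)%N by lia.
  have -> : (m.+1 - m - 1 = 0)%N by lia.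
  have -> : (m - m - 1 = 0)%N by lia.
  by rewrite /=; ring.
Qed.

Lemma diff2_inj (R : realType) (g g' : nat -> R) :
  g 0%N = g' 0%N -> g 1%N = g' 1%N -> diff2 g =1 diff2 g' -> g =1 g'.
Proof.
move=> g0 g1 gg'; suff H n : g n = g' n /\ g n.+1 = g' n.+1.
  by move=> n; have [] := H n.
elim: n => [//|n [gn gn1]]; split=> //.
by have := gg' n; rewrite /diff2 gn gn1; lra.
Qed.

(** Both sides of the moment formula are determined by their values at [0] and
    [1] and by their second differences, and that of [Q R] is ['X^m]. *)
Lemma triplet_formulaP (R : realType) (g : nat -> R) (b c : R)
    (nu : {finite_measure set (measurableTypeR R) -> \bar R}) :
  compactly_supported nu ->
  (forall n : nat, ((g n)%:E = (1 + b * n%:R + c * n%:R ^+ 2)%:E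
     + \int[nu]_(x in `[0%R, +oo[) ((Q R n).[x])%:E)%E) <->
  [/\ g 0%N = 1, g 1%N = 1 + b + c &
      forall m, diff2 g m = 2 * c + moment nu m].
Proof.
move=> cnu; pose h (n : nat) :=
  1 + b * n%:R + c * n%:R ^+ 2 + riesz (moment nu) (Q R n).
have Q01 n : (n < 2)%N -> Q R n = 0.
  by case: n => [|[|//]] _; apply/polyP => i; rewrite coef_poly coef0.
have h0 : h 0%N = 1 by rewrite /h Q01// linear0; ring.
have h1 : h 1%N = 1 + b + c by rewrite /h Q01// linear0; ring.
have h2 m : diff2 h m = 2 * c + moment nu m.
  rewrite -(rieszXn (moment nu)) -diff2_Q !linearD linearN linearZ/= /diff2 /h.
  have -> : m.+2%:R = m%:R + 2 :> R by rewrite -addn2 natrD.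
  have -> : m.+1%:R = m%:R + 1 :> R by rewrite -addn1 natrD.
  ring.
have -> : (forall n : nat, ((g n)%:E = (1 + b * n%:R + c * n%:R ^+ 2)%:E
     + \int[nu]_(x in `[0%R, +oo[) ((Q R n).[x])%:E)%E) <-> g =1 h.
  split=> gh n; first by apply: EFin_inj; rewrite gh -riesz_moment.
  by rewrite gh -riesz_moment.
split=> [gh|[g0 g1 g2]]; last by apply: diff2_inj => [||m]; rewrite ?h0 ?h1 ?h2.
by rewrite !gh h0 h1; split=> // m; rewrite /diff2 !gh -h2.
Qed.

(** The second difference of the moments shifted by [k] represents the functional
    that sends q to 2 c q(1) plus the integral of q x^k against nu; it is
    nonnegative on squares since nu lives on the half-line. *)
Lemma triplet_cpd (R : realType) (w : nat -> R) (b c : R)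
    (nu : {finite_measure set (measurableTypeR R) -> \bar R}) :
  (forall k, 0 < w k) -> (exists M, forall k, w k <= M) ->
  scalar_triplet w b c nu -> cpd_operator (wshift w).
Proof.
move=> w0 wM [c0 cnu _ /(triplet_formulaP _ _ _ cnu)[_ _ w2]].
apply: cpd_operator_wshift => // k; apply/cpd_seq_diff2 => p.
have -> : diff2 (fun n => hat w (n + k)%N) = fun m => 2 * c + moment nu (m + k).
  by apply/funext => m; rewrite -w2.
have -> : riesz (fun m => 2 * c + moment nu (m + k)) (p ^+ 2) =
    2 * c * (p ^+ 2).[1] + riesz (moment nu) ('X^k * p ^+ 2).
  rewrite rieszXnM horner_coef mulr_sumr /riesz -big_split/=.
  by apply: eq_bigr => i _; rewrite expr1n; ring.
apply: addr_ge0; first by rewrite !mulr_ge0// horner_exp sqr_ge0.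
rewrite -lee_fin riesz_moment//; apply: integral_ge0 => x /=.
rewrite in_itv/= andbT => x0.
rewrite lee_fin hornerM hornerXn horner_exp.
by apply: mulr_ge0; [exact: exprn_ge0|exact: sqr_ge0].
Qed.

(** * Backward extensions *)

Lemma prod_sqr0 (R : realType) (t : nat -> R) : prod_sqr t 0 = 1.
Proof. by rewrite /prod_sqr big_geq. Qed.

Lemma prod_sqrS (R : realType) (t : nat -> R) (k : nat) :
  prod_sqr t k.+1 = prod_sqr t k * t k.+1 ^+ 2.
Proof. by rewrite /prod_sqr big_nat_recr. Qed.

Lemma hat_backwardS (R : realType) (k : nat) (t lam : nat -> R) (m : nat) :
  hat (backward_weights k.+1 t lam) m.+1 =
  t k.+1 ^+ 2 * hat (backward_weights k t lam) m.
Proof. by rewrite /hat big_nat_recl. Qed.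

Lemma hat_backward1 (R : realType) (k : nat) (t lam : nat -> R) :
  t 0%N = lam 0%N -> hat (backward_weights k t lam) 1 = t k ^+ 2.
Proof.
by move=> t0E; rewrite /hat big_nat1 /backward_weights; case: k => [|k]/=;
  rewrite ?t0E.
Qed.

Lemma hat0 (R : realType) (w : nat -> R) : hat w 0 = 1.
Proof. by rewrite /hat big_geq. Qed.

Lemma diff2_backward0 (R : realType) (k : nat) (t lam : nat -> R) :
  t 0%N = lam 0%N ->
  diff2 (hat (backward_weights k.+1 t lam)) 0 =
  t k.+1 ^+ 2 * t k ^+ 2 - 2 * t k.+1 ^+ 2 + 1.
Proof. by move=> t0E; rewrite /diff2 hat_backwardS !hat_backward1// hat0. Qed.

(** Prepending [j] weights shifts the moments by [j] and multiplies them by the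
    squares of the new weights. *)
Lemma diff2_backward_add (R : realType) (k j : nat) (t lam : nat -> R)
    (m : nat) :
  prod_sqr t k * diff2 (hat (backward_weights (k + j) t lam)) (m + j) =
  prod_sqr t (k + j) * diff2 (hat (backward_weights k t lam)) m.
Proof.
elim: j => [|j IH]; first by rewrite !addn0.
rewrite !addnS prod_sqrS mulrAC -IH /diff2 !hat_backwardS; ring.
Qed.

Lemma backward_weights_gt0 (R : realType) (k : nat) (t lam : nat -> R) :
  (forall j, 0 < lam j) -> (forall j, (1 <= j <= k)%N -> 0 < t j) ->
  forall i, 0 < backward_weights k t lam i.
Proof.
move=> lam0 t0 i; rewrite /backward_weights; case: ltnP => // ik.
by apply: t0; rewrite subn_gt0 ik leq_subr.
Qed.

Lemma backward_weights_bounded (R : realType) (k : nat) (t lam : nat -> R) :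
  (exists M, forall j, lam j <= M) ->
  exists M, forall i, backward_weights k t lam i <= M.
Proof.
move=> [M lamM]; exists (Num.max M (\big[Num.max/M]_(j < k.+1) t j)) => i.
rewrite /backward_weights; case: ltnP => ik; rewrite le_max ?lamM//.
apply/orP; right; have kik : (k - i < k.+1)%N by rewrite ltnS leq_subr.
exact: (le_bigmax M (fun j : 'I_k.+1 => t j) (Ordinal kik)).
Qed.

(** Multiplication by [a > 0] and moving the finite term across; when [X] is
    infinite, both statements of each equivalence fail. *)
Lemma ext_rhs_fine (R : realType) (P a y : R) (X : \bar R) :
  0 < P -> 0 < a -> (0 <= X)%E ->
  ((1 / a)%:E = P%:E * X + (2 - y)%:E <->
     (a * y - 2 * a + 1)%:E = (P * a)%:E * X)%E /\
  ((P%:E * X + (2 - y)%:E <= (1 / a)%:E)%E <->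
     ((P * a)%:E * X <= (a * y - 2 * a + 1)%:E)%E).
Proof.
move=> P0 a0; case: X => [x|_|//]; last first.
  by rewrite !gt0_muley ?lte_fin ?mulr_gt0//.
move=> _; rewrite -!EFinM -!EFinD !lee_fin.
have aV : a * (1 / a) = 1 by rewrite mulrC mulfVK// gt_eqF.
split; split.
- move=> [E1]; congr EFin; rewrite -[X in _ + X = _]aV E1; ring.
- by move=> [E1]; congr EFin; apply: (mulfI (lt0r_neq0 a0)); rewrite aV; lra.
- by move=> /(ler_wpM2l (ltW a0)); rewrite aV => E1; lra.
- by move=> E1; rewrite -(ler_pM2l a0) aV; lra.
Qed.

Lemma prod_sqr_gt0 (R : realType) (t : nat -> R) (k : nat) :
  (forall j, (1 <= j <= k)%N -> 0 < t j) -> 0 < prod_sqr t k.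
Proof.
move=> t0; rewrite /prod_sqr big_nat_cond prodr_gt0// => j /andP[jk _].
by rewrite exprn_gt0// t0.
Qed.

Lemma int_invX_ge0 (R : realType)
    (nu : {finite_measure set (measurableTypeR R) -> \bar R}) (k : nat) :
  (0 <= int_invX nu k `[0%R, +oo[)%E.
Proof.
by apply: integral_ge0 => x /=; rewrite in_itv/= andbT; exact: invX_ge0.
Qed.

(** The integral of [x ^- k] against the measure [nu + 2 * c * \d_1], whose
    moments are the second differences of [hat lam]. *)
Definition neg_moment (R : realType) (c : R)
    (nu : {finite_measure set (measurableTypeR R) -> \bar R}) (k : nat) :
    \bar R :=
  (int_invX nu k `[0%R, +oo[ + (2 * c)%:E)%E.

(** The second difference at [0] for the [k]-step extension is
    [t k ^+ 2 * (t k.-1 ^+ 2 - 2 + 1 / t k ^+ 2)], so multiplying the [k]-th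
    condition by [t k ^+ 2] isolates the negative moment. *)
Lemma ext_conditionsE (R : realType) (lam t : nat -> R) (c : R)
    (nu : {finite_measure set (measurableTypeR R) -> \bar R}) (n : nat) :
  0 <= c -> (0 < n)%N -> (forall j, (1 <= j <= n)%N -> 0 < t j) ->
  t 0%N = lam 0%N ->
  ext_conditions c nu n t <->
  (forall k, (1 <= k <= n.-1)%N ->
     (diff2 (hat (backward_weights k t lam)) 0)%:E =
     (prod_sqr t k)%:E * neg_moment c nu k)%E /\
  ((prod_sqr t n)%:E * neg_moment c nu n <=
     (diff2 (hat (backward_weights n t lam)) 0)%:E)%E.
Proof.
move=> c0 n0 t0 t0E.
have condE k : (1 <= k <= n)%N ->
    ((1 / t k ^+ 2)%:E = ext_rhs c nu t k <->
     (diff2 (hat (backward_weights k t lam)) 0)%:E =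
     (prod_sqr t k)%:E * neg_moment c nu k)%E /\
    ((ext_rhs c nu t k <= (1 / t k ^+ 2)%:E)%E <->
     ((prod_sqr t k)%:E * neg_moment c nu k <=
      (diff2 (hat (backward_weights k t lam)) 0)%:E)%E).
  case: k => // k kn; rewrite diff2_backward0// prod_sqrS /ext_rhs /=.
  apply: ext_rhs_fine.
  - apply: prod_sqr_gt0 => j /andP[j1 jk].
    by rewrite t0// j1 (leq_trans jk)// ltnW.
  - by rewrite exprn_gt0// t0.
  - by apply: adde_ge0; [exact: int_invX_ge0|rewrite lee_fin mulr_ge0].
have nn : (1 <= n <= n)%N by rewrite n0 leqnn.
have kn k : (1 <= k <= n.-1)%N -> (1 <= k <= n)%N by lia.
by split=> -[eqs ineq]; split=> [k kn1|]; first
  [exact/(condE k (kn k kn1)).1/eqs|exact/(condE n nn).2].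
Qed.

(** Divided by [prod_sqr t n], the second differences for the [n]-step extension
    continue the moments of [nu + 2 * c * \d_1] by [n] ranks; rank [n - k] is, up
    to the factor [prod_sqr t k], rank [0] for the [k]-step extension. *)
Lemma backward_necessary (R : realType) (lam t : nat -> R) (b c : R)
    (nu : {finite_measure set (measurableTypeR R) -> \bar R}) (n : nat) :
  scalar_triplet lam b c nu -> (0 < n)%N ->
  (forall j, (1 <= j <= n)%N -> 0 < t j) ->
  cpd_seq (hat (backward_weights n t lam)) ->
  (forall k, (1 <= k <= n.-1)%N ->
     (diff2 (hat (backward_weights k t lam)) 0)%:E =
     (prod_sqr t k)%:E * neg_moment c nu k)%E /\
  ((prod_sqr t n)%:E * neg_moment c nu n <=
     (diff2 (hat (backward_weights n t lam)) 0)%:E)%E.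
Proof.
move=> [c0 cnu _ /(triplet_formulaP _ _ _ cnu)[_ _ lam2]] n0 t0.
move=> /cpd_seq_diff2 npos.
have [mu [cmu _ mumom muX]] :=
  add_atom cnu (@ler01 R) (mulr_ge0 (ler0n R 2) c0).
have muE k : int_invX mu k `[0%R, +oo[ = neg_moment c nu k.
  by rewrite muX expr1n inve1 mule1.
pose s k := diff2 (hat (backward_weights k t lam)).
have P0 k : (k <= n)%N -> 0 < prod_sqr t k.
  move=> kn; apply: prod_sqr_gt0 => j /andP[j1 jk].
  by rewrite t0// j1 (leq_trans jk).
have s0E m : s 0%N m = moment mu m.
  rewrite mumom expr1n mulr1 addrC -lam2 /s; congr (diff2 (hat _) m).
  by apply/funext => i; rewrite /backward_weights subn0.
pose s' m := (prod_sqr t n)^-1 * s n m.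
have s'pos q : 0 <= riesz s' (q ^+ 2).
  rewrite (_ : riesz s' _ = (prod_sqr t n)^-1 * riesz (s n) (q ^+ 2)).
    by apply: mulr_ge0 (npos q); rewrite invr_ge0 ltW// P0.
  by rewrite /riesz mulr_sumr; apply: eq_bigr => i _; rewrite mulrA.
have s'E k m : (k <= n)%N -> s' (m + (n - k))%N = (prod_sqr t k)^-1 * s k m.
  move=> kn; have := diff2_backward_add k (n - k) t lam m.
  rewrite subnKC// -/(s n) -/(s k) => eqs.
  have Pk := lt0r_neq0 (P0 _ kn); have Pn := lt0r_neq0 (P0 _ (leqnn n)).
  apply: (mulfI Pn); apply: (mulfI Pk).
  by rewrite /s' mulVKf// eqs [RHS]mulrCA mulVKf.
have s'mu m : s' (m + n)%N = moment mu m.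
  by have := s'E 0%N m isT; rewrite subn0 s0E prod_sqr0 invr1 mul1r.
have [ineq eqs] := backward_moments n0 cmu s'pos s'mu.
split=> [k /andP[k1 kn]|].
  have kltn : (k < n)%N by rewrite -(prednK n0) ltnS.
  have := eqs (n - k)%N; rewrite subKn ?(ltnW kltn)// muE => <-.
    have := s'E k 0%N (ltnW kltn); rewrite add0n => ->.
    by rewrite -EFinM mulVKf// lt0r_neq0// P0// ltnW.
  by rewrite subn_gt0 kltn ltn_subrL k1 n0.
have -> : diff2 (hat (backward_weights n t lam)) 0 = prod_sqr t n * s' 0%N.
  by rewrite /s' mulVKf// lt0r_neq0// P0.
by rewrite EFinM lee_pmul2l// ?lte_fin ?P0// -muE.
Qed.

(** The atom at [0] takes up the excess at rank [0]; at positive ranks it is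
    invisible, and there the moments of [prod_sqr t k * x ^- k * nu] are right
    by the equalities for the smaller indices. *)
Lemma backward_triplet (R : realType) (lam t : nat -> R) (b c : R)
    (nu : {finite_measure set (measurableTypeR R) -> \bar R}) (k : nat) :
  scalar_triplet lam b c nu -> (0 < k)%N ->
  (forall j, (1 <= j <= k)%N -> 0 < t j) -> t 0%N = lam 0%N ->
  (forall j, (1 <= j < k)%N ->
     (diff2 (hat (backward_weights j t lam)) 0)%:E =
     (prod_sqr t j)%:E * neg_moment c nu j)%E ->
  ((prod_sqr t k)%:E * neg_moment c nu k <=
     (diff2 (hat (backward_weights k t lam)) 0)%:E)%E ->
  exists nuk : {finite_measure set (measurableTypeR R) -> \bar R},
  exists x : R,
    [/\ scalar_triplet (backward_weights k t lam)
          (t k ^+ 2 - c * prod_sqr t k - 1) (c * prod_sqr t k) nuk,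
        (forall D : set (measurableTypeR R),
           measurable D -> D `<=` `[0, +oo[ ->
           nuk D = ((prod_sqr t k)%:E * int_invX nu k D
                      + nuk [set 0%R] * \d_(0%R : R) D)%E),
        neg_moment c nu k = x%:E &
        nuk [set 0] = (diff2 (hat (backward_weights k t lam)) 0
                         - prod_sqr t k * x)%:E].
Proof.
move=> [c0 cnu nu1 /(triplet_formulaP _ _ _ cnu)[_ _ lam2]] k0 t0 t0E eqs ineq.
pose s j := diff2 (hat (backward_weights j t lam)).
have P0 j : (j <= k)%N -> 0 < prod_sqr t j.
  move=> jk; apply: prod_sqr_gt0 => i /andP[i1 ij].
  by rewrite t0// i1 (leq_trans ij).
have Pk := P0 k (leqnn k).
have s0E m : s 0%N m = 2 * c + moment nu m.
  rewrite -lam2 /s; congr (diff2 (hat _) m).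
  by apply/funext => i; rewrite /backward_weights subn0.
have Xfin : (int_invX nu k `[0%R, +oo[ < +oo)%E.
  rewrite ltey; apply/eqP => Xoo; move: ineq.
  by rewrite /neg_moment Xoo addye// gt0_muley ?lte_fin.
have nu0 := int_invX_lty_null k0 Xfin.
have [kap [ckap kapD _ kaplt kapge]] := inv_power_measure k0 cnu Xfin.
have [Pkap [cPkap PkapE Pkapmom]] := scale_measure ckap (ltW Pk).
have XE : neg_moment c nu k = (moment kap 0 + 2 * c)%:E.
  by rewrite EFinD kaplt// subn0.
pose a := s k 0%N - prod_sqr t k * (moment kap 0 + 2 * c).
have a0 : 0 <= a by move: ineq; rewrite XE -EFinM lee_fin subr_ge0.
have [nuk [cnuk nukE nukmom _]] := add_atom cPkap (lexx 0) a0.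
have nuk0 : nuk [set 0] = a%:E.
  rewrite nukE PkapE kapD//; last by move=> x /= ->; rewrite in_itv/= lexx.
  rewrite /int_invX null_set_integral//; last exact: measurable_invX.
  by rewrite mule0 add0e diracE mem_set// mule1.
have skm m : s k m = 2 * (c * prod_sqr t k) + moment nuk m.
  rewrite nukmom Pkapmom.
  case: m => [|m]; first by rewrite /a expr0; ring.
  rewrite expr0n mulr0 addr0; have [mk|km] := ltnP m.+1 k; last first.
    have := diff2_backward_add 0 k t lam (m.+1 - k).
    rewrite subnK// add0n prod_sqr0 mul1r -/(s k) -/(s 0) s0E => ->.
    by rewrite -{2}(subnK km) kapge; ring.
  have := diff2_backward_add (k - m.+1) m.+1 t lam 0.
  rewrite subnK ?(ltnW mk)// add0n -/(s k) -/(s _) => skE.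
  have Pkm : 0 < prod_sqr t (k - m.+1) by rewrite P0// leq_subr.
  apply: (mulfI (lt0r_neq0 Pkm)); rewrite skE.
  have -> : s (k - m.+1)%N 0%N =
      prod_sqr t (k - m.+1) * (moment kap m.+1 + 2 * c).
    apply: EFin_inj; rewrite eqs; last by lia.
    by rewrite /neg_moment -kaplt// EFinM EFinD.
  by ring.
exists nuk, (moment kap 0 + 2 * c); split=> //.
  split=> //.
  - by rewrite mulr_ge0// ltW.
  - rewrite nukE PkapE kapD//; last by move=> x /= ->; rewrite in_itv/= ler01.
    rewrite /int_invX null_set_integral//; last exact: measurable_invX.
    rewrite mule0 add0e diracE memNset ?mule0//=.
    by move/esym/eqP; rewrite oner_eq0.
  - apply/triplet_formulaP => //; split=> //; first by rewrite hat0.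
    by rewrite hat_backward1//; ring.
by move=> D mD D0; rewrite nuk0 nukE PkapE kapD.
Qed.

Theorem theorem7p3 (R : realType) (lam : nat -> R) (b c : R)
    (nu : {finite_measure set (measurableTypeR R) -> \bar R})
    (n : nat) (t : nat -> R)
    (lam_gt0 : forall k : nat, 0 < lam k)
    (lam_bounded : exists M : R, forall k : nat, lam k <= M)
    (W_cpd : cpd_operator (wshift lam))
    (W_triplet : scalar_triplet lam b c nu)
    (n_ge2 : (2 <= n)%N)
    (t_gt0 : forall j : nat, (1 <= j <= n)%N -> 0 < t j)
    (t0E : t 0%N = lam 0%N) :
  [/\ lam 0%N = Num.sqrt (1 + b + c),
      cpd_backward_extension n t lam <-> ext_conditions c nu n t &
      ext_conditions c nu n t ->
      forall k : nat, (1 <= k <= n)%N ->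
        cpd_backward_extension k t lam /\
        exists nuk : {finite_measure set (measurableTypeR R) -> \bar R},
          [/\ scalar_triplet (backward_weights k t lam)
                (t k ^+ 2 - c * prod_sqr t k - 1) (c * prod_sqr t k) nuk,
              (forall D : set (measurableTypeR R),
                 measurable D -> D `<=` `[0, +oo[ ->
                 nuk D = ((prod_sqr t k)%:E * int_invX nu k D
                            + nuk [set 0%R] * \d_(0%R : R) D)%E),
              nuk [set 0] = (1 - (prod_sqr t k)%:E
                                 * (int_invX nu k `[0%R, +oo[ + (2 * c)%:E)
                               + (t k ^+ 2 * (t k.-1 ^+ 2 - 2))%:E)%E &
              (k <= n.-1)%N -> nuk [set 0] = 0%E]].
Proof.
have [c0 cnu _ /(triplet_formulaP _ _ _ cnu)[_ lam1 _]] := W_triplet.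
have n0 : (0 < n)%N by rewrite ltnW.
have condE := ext_conditionsE nu c0 n0 t_gt0 t0E.
have ext k : ext_conditions c nu n t -> (1 <= k <= n)%N ->
    cpd_backward_extension k t lam /\
    exists nuk : {finite_measure set (measurableTypeR R) -> \bar R},
      [/\ scalar_triplet (backward_weights k t lam)
            (t k ^+ 2 - c * prod_sqr t k - 1) (c * prod_sqr t k) nuk,
          (forall D : set (measurableTypeR R),
             measurable D -> D `<=` `[0, +oo[ ->
             nuk D = ((prod_sqr t k)%:E * int_invX nu k D
                        + nuk [set 0%R] * \d_(0%R : R) D)%E),
          nuk [set 0] = (1 - (prod_sqr t k)%:E
                             * (int_invX nu k `[0%R, +oo[ + (2 * c)%:E)
                           + (t k ^+ 2 * (t k.-1 ^+ 2 - 2))%:E)%E &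
          (k <= n.-1)%N -> nuk [set 0] = 0%E].
  move=> /condE[eqs ineq] /andP[k1 kn].
  have tk0 j : (1 <= j <= k)%N -> 0 < t j by move=> jk; apply: t_gt0; lia.
  have ineqk : ((prod_sqr t k)%:E * neg_moment c nu k <=
      (diff2 (hat (backward_weights k t lam)) 0)%:E)%E.
    have [kn1|nk] := leqP k n.-1; first by rewrite -eqs ?k1.
    by have -> : k = n by lia.
  have kn1 j : (1 <= j < k)%N -> (1 <= j <= n.-1)%N by lia.
  have [nuk [x [tri nukD xE nuk0]]] :=
    backward_triplet W_triplet k1 tk0 t0E (fun j jk => eqs j (kn1 j jk)) ineqk.
  split.
    apply: (triplet_cpd _ _ tri); last exact: backward_weights_bounded.
    exact: backward_weights_gt0.
  exists nuk; split=> //.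
  - rewrite nuk0 -/(neg_moment c nu k) xE -(prednK k1) diff2_backward0//=.
    by rewrite -!EFinD; congr EFin; ring.
  - move=> kn2; rewrite nuk0; congr EFin; apply/eqP; rewrite subr_eq0.
    by apply/eqP; apply: EFin_inj; rewrite eqs ?k1// xE EFinM.
split.
- by rewrite -lam1 /hat big_nat1 sqrtr_sqr gtr0_norm.
- split=> [/cpd_seq_hat ncpd|cond].
    by apply/condE; exact: backward_necessary W_triplet n0 t_gt0 ncpd.
  by have [] := ext n cond; rewrite ?leqnn ?n0.
- by move=> cond k kn; exact: ext.
Qed.
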